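(* Let $F$ be a finite factor closed set of positive integers and let $B\ge 1$ be an integer. Let $N(B,F)$ be the number of quadruples $(n_1,n_2,n_3,n_4)$ of integers with $n_1n_2=n_3n_4$, $1\le n_1\le B$, $1\le n_3\le B$, $n_2,n_4\in F$; let $N(F,F)$ be the number of quadruples $(n_1,n_2,n_3,n_4)\in F^4$ with $n_1n_2=n_3n_4$. Then $$N(B,F)=\sum_{\substack{n,m\in F\\ \gcd(n,m)=1}}\Big(\sum_{\substack{\mu,\nu\in F\\ \nu/\mu=m/n}}1\Big)\Big\lfloor\frac{B}{\max(n,m)}\Big\rfloor .$$ If moreover $F\subset[1,B]$, then $$N(B,F)\le 2B^2\sum_{\substack{n\in F\\ n\ne 1}}\frac1n+B^2,$$ $$N(B,F)\ge\sum_{\mu,\nu\in F}\gcd(\mu,\nu),$$ $$N(F,F)=\sum_{\substack{n,m\in F\\ \gcd(n,m)=1}}\Big(\sum_{\substack{n_2,n_4\in F\\ n_4/n_2=m/n}}1\Big)^2 .$$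
   Context: A finite set $F$ of positive integers is called factor closed (an FC set) if for every $k\in F$ and every positive divisor $d$ of $k$ one has $d\in F$; in particular $1\in F$ (so $F$ is nonempty). Sums over $n,m\in F$ (or $\mu,\nu\in F$, or $n_2,n_4\in F$) run over ordered pairs. $\lfloor x\rfloor$ is the integer part of $x$. *)

(* Defs.v *)
From mathcomp Require Import all_boot all_order all_algebra finmap.
Set Implicit Arguments.
Unset Strict Implicit.
Unset Printing Implicit Defensive.
Import Order.TTheory GRing.Theory Num.Theory.

Local Open Scope fset_scope.

(* A factor closed set consists of positive integers and is nonempty, so that
   it contains 1. *)
Definition factor_closed (F : {fset nat}) : Prop :=
  [/\ F != fset0,
      forall k : nat, k \in F -> 0 < k
    & forall k d : nat, k \in F -> d %| k -> d \in F].

Definition interval1 (B : nat) : {fset nat} := [fset n in iota 1 B].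

(* N(B, F) is quad_count (interval1 B) F and N(F, F) is quad_count F F; the
   product order A, F, A, F is that of (n1, n2, n3, n4). *)
Definition quad_count (A F : {fset nat}) : nat :=
  #|` [fset q in A `*` F `*` A `*` F
        | let: (n1, n2, n3, n4) := q in n1 * n2 == n3 * n4] |.

(* The inner sum over (a, b) = (mu, nu) or (n2, n4); its quotient condition is
   the equality of rationals b / a = m / n, with n the denominator. *)
Definition ratio_count (F : {fset nat}) (n m : nat) : nat :=
  \sum_(a <- F) \sum_(b <- F | (b%:R / a%:R == m%:R / n%:R :> rat)%R) 1.

(* Main.v *)
(* A quadruple with n1 n2 = n3 n4 is a pair (n2, n4) in F and a pair (n3, n1) in
   A with the same ratio. Grouping by the reduced form m / n of that ratio gives
   N(A, F) = sum of R_F(n, m) R_A(n, m) over coprime n, m in F, R_A(n, m) being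
   the number of pairs in A of ratio m / n: this is the formula for N(F, F) when
   A = F, and the one for N(B, F) when A = [1, B], as R_A(n, m) is then
   floor(B / max(n, m)). For the upper bound, F in [1, B] gives
   R_F <= R_[1, B] <= B / max(n, m); the terms with m < n sum to at most
   n (B / n)^2, and only n = m = 1 lies on the diagonal. For the lower bound, a
   pair (a, b) in F has gcd(a, b) max(a, b) / gcd(a, b) <= B, so that at least
   gcd(a, b) pairs in [1, B] have its ratio. *)
Require Import Defs.
From mathcomp Require Import all_boot all_order all_algebra finmap.
Import Order.TTheory GRing.Theory Num.Theory.
Local Open Scope ring_scope.

(** * Sums over products of finite sets and Kronecker deltas *)

Lemma big_fsetM_nat (K K' : choiceType) (A : {fset K}) (E : {fset K'})
    (f : K * K' -> nat) :
  (\sum_(p <- (A `*` E)%fset) f p = \sum_(a <- A) \sum_(b <- E) f (a, b))%N.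
Proof.
rewrite -big_allpairs; apply: perm_big; apply: uniq_perm.
- exact: fset_uniq.
- by apply: allpairs_uniq; rewrite ?fset_uniq // => -[? ?] [? ?].
- move=> [a b]; rewrite in_fsetM /=; apply/andP/allpairsP => [[aA bE]|].
    by exists (a, b).
  by case=> -[a' b'] [/= aA bE [-> ->]].
Qed.

(** The delta is a factor rather than a filter, so that sums can be exchanged freely before being
    collapsed. *)
Lemma sum_pred1_nat (s : seq nat) (x : nat) (f : nat -> nat) : uniq s ->
  (\sum_(i <- s) (i == x) * f i = (x \in s) * f x)%N.
Proof.
move=> us; under eq_bigr => i _ do rewrite mulnbl.
rewrite -big_mkcond /=; have [xs|xs] := boolP (x \in s); last first.
  rewrite big_seq_cond big1 ?mul0n // => i /andP[si /eqP eix].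
  by rewrite -eix si in xs.
by rewrite mul1n -big_filter filter_pred1_uniq // big_seq1.
Qed.

(** Division by zero in [rat] gives zero, so cross-multiplying relies on positive denominators. *)
Lemma eq_frac_nat (a b n m : nat) : (0 < a)%N -> (0 < n)%N ->
  (b%:R / a%:R == m%:R / n%:R :> rat) = (b * n == m * a)%N.
Proof.
move=> a0 n0; rewrite eqr_div ?pnatr_eq0 -?lt0n //.
by rewrite -!natrM eqr_nat.
Qed.

(** * Quadruples as pairs of equal ratio *)

Definition positive_fset (A : {fset nat}) := forall k : nat, k \in A -> (0 < k)%N.

Lemma ratio_countE (A : {fset nat}) (n m : nat) :
  positive_fset A -> (0 < n)%N ->
  ratio_count A n m = (\sum_(a <- A) \sum_(b <- A) (b * n == m * a))%N.
Proof.
move=> Apos n0; rewrite /ratio_count big_seq [RHS]big_seq.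
apply: eq_bigr => a /Apos a0; rewrite big_mkcond; apply: eq_bigr => b _.
by rewrite eq_frac_nat //; case: eqP.
Qed.

Lemma quad_count_pairs (A F : {fset nat}) :
  positive_fset A -> positive_fset F ->
  quad_count A F = (\sum_(a <- F) \sum_(b <- F) ratio_count A a b)%N.
Proof.
move=> Apos Fpos; rewrite /quad_count card_fset_sum1.
rewrite big_fset /= big_mkcond !big_fsetM_nat /=.
under [in RHS]eq_big_seq => a aF do
  under eq_bigr => b _ do rewrite (ratio_countE _ _ _ Apos (Fpos _ aF)).
(* The exchanges take the order [n1, n2, n3, n4] to [n2, n4, n3, n1]. *)
under eq_bigr => n1 _ do under eq_bigr => n2 _ do rewrite exchange_big /=.
rewrite exchange_big /=; apply: eq_bigr => n2 _.
rewrite exchange_big /=; apply: eq_bigr => n4 _.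
rewrite exchange_big /=; apply: eq_bigr => n3 _.
by apply: eq_bigr => n1 _; rewrite (mulnC n4); case: eqP.
Qed.

(** * Grouping by reduced ratio *)

Lemma coprime_div_gcd (a b : nat) :
  (0 < a)%N -> coprime (a %/ gcdn a b) (b %/ gcdn a b).
Proof.
move=> a0; have g0 : (0 < gcdn a b)%N by rewrite gcdn_gt0 a0.
rewrite /coprime -(eqn_pmul2r g0) muln_gcdl mul1n.
by rewrite !divnK ?dvdn_gcdl ?dvdn_gcdr.
Qed.

(** By Gauss, [n] divides [a]; writing [a = t * n] gives [b = t * m], and coprimality makes [t] the
    gcd of [a] and [b]. *)
Lemma coprime_fracE (a b n m : nat) :
  (0 < a)%N -> (0 < n)%N -> coprime n m ->
  (b * n == m * a)%N =
    (n == a %/ gcdn a b)%N && (m == b %/ gcdn a b)%N.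
Proof.
move=> a0 n0 co; have g0 : (0 < gcdn a b)%N by rewrite gcdn_gt0 a0.
apply/eqP/andP => [E|[/eqP-> /eqP->]]; last first.
  by rewrite [RHS]mulnC muln_divCA_gcd.
have nda : (n %| a)%N by rewrite -(Gauss_dvdr _ co) -E dvdn_mull.
have [t at_] := dvdnP nda; subst a.
have bt : b = (t * m)%N.
  by apply/eqP; rewrite -(eqn_pmul2r n0) E mulnA (mulnC m).
subst b; move: g0; rewrite -muln_gcdr (eqP co) muln1 => t0.
by rewrite !mulKn // !eqxx.
Qed.

(* Each pair of [F] has a unique reduced ratio, whose two terms lie in [F]. *)
Lemma sum_ratio_count (F : {fset nat}) (g : nat -> nat -> nat) :
  factor_closed F ->
  (\sum_(n <- F) \sum_(m <- F | coprime n m) ratio_count F n m * g n m =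
   \sum_(a <- F) \sum_(b <- F) g (a %/ gcdn a b) (b %/ gcdn a b))%N.
Proof.
move=> [_ Fpos Fdiv].
(* The two deltas absorb the coprimality condition: they force [n] and [m] to be quotients by a gcd,
   which are coprime. *)
transitivity (\sum_(n <- F) \sum_(m <- F) \sum_(a <- F) \sum_(b <- F)
   (n == a %/ gcdn a b) * ((m == b %/ gcdn a b) * g n m))%N.
  apply: eq_big_seq => n /Fpos n0; rewrite big_mkcond; apply: eq_bigr => m _.
  rewrite ratio_countE //; case: ifPn => co.
    rewrite big_distrl /=; apply: eq_big_seq => a /Fpos a0.
    rewrite big_distrl /=; apply: eq_bigr => b _.
    by rewrite coprime_fracE // mulnA mulnb.
  rewrite big_seq big1 // => a /Fpos a0; rewrite big1 // => b _.
  case: eqP => // En; case: eqP => // Em; case/negP: co.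
  by rewrite En Em coprime_div_gcd.
under eq_bigr => n _ do rewrite exchange_big /=.
rewrite exchange_big /=; apply: eq_big_seq => a aF.
under eq_bigr => n _ do rewrite exchange_big /=.
rewrite exchange_big /=; apply: eq_big_seq => b bF.
under eq_bigr => n _ do rewrite -big_distrr /=.
rewrite sum_pred1_nat ?fset_uniq // sum_pred1_nat ?fset_uniq //.
(* Factor closure enters here: both quotients divide elements of [F]. *)
have -> : (a %/ gcdn a b)%N \in F by apply: Fdiv aF _; rewrite dvdn_div ?dvdn_gcdl.
have -> : (b %/ gcdn a b)%N \in F by apply: Fdiv bF _; rewrite dvdn_div ?dvdn_gcdr.
by rewrite !mul1n.
Qed.

Lemma ratio_count_reduced (A : {fset nat}) (a b : nat) :
  positive_fset A -> (0 < a)%N ->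
  ratio_count A (a %/ gcdn a b)%N (b %/ gcdn a b)%N = ratio_count A a b.
Proof.
move=> Apos a0; have g0 : (0 < gcdn a b)%N by rewrite gcdn_gt0 a0.
have ag0 : (0 < a %/ gcdn a b)%N by rewrite divn_gt0 // dvdn_leq // dvdn_gcdl.
rewrite !ratio_countE //.
apply: eq_bigr => c _; apply: eq_bigr => d _; congr nat_of_bool.
rewrite -(eqn_pmul2r g0) -mulnA divnK ?dvdn_gcdl //.
by rewrite mulnAC divnK ?dvdn_gcdr.
Qed.

Lemma quad_countE (A F : {fset nat}) : positive_fset A -> factor_closed F ->
  quad_count A F =
  (\sum_(n <- F) \sum_(m <- F | coprime n m)
     ratio_count F n m * ratio_count A n m)%N.
Proof.
move=> Apos FC; have [_ Fpos _] := FC.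
rewrite (sum_ratio_count F (ratio_count A)) // quad_count_pairs //.
apply: eq_big_seq => a aF; apply: eq_bigr => b _.
by rewrite ratio_count_reduced // Fpos.
Qed.

(** * Pairs of given ratio in [[1, B]] *)

Lemma mem_interval1 (B k : nat) : (k \in interval1 B) = (1 <= k <= B)%N.
Proof. by rewrite in_fset /= mem_iota add1n ltnS. Qed.

Lemma interval1_pos (B : nat) : positive_fset (interval1 B).
Proof. by move=> k; rewrite mem_interval1 => /andP[]. Qed.

(* For coprime [n] and [m], the pairs of ratio [m / n] are the [(n t, m t)]. *)
Lemma ratio_count_interval1 (B n m : nat) :
  (0 < n)%N -> (0 < m)%N -> coprime n m ->
  ratio_count (interval1 B) n m = (B %/ maxn n m)%N.
Proof.
move=> n0 m0 co; rewrite ratio_countE //; last exact: interval1_pos.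
set I := interval1 B.
have mul_le k t : (0 < k)%N -> (k * t <= B)%N -> (t <= B)%N.
  by move=> k0; apply: leq_trans; rewrite leq_pmull.
(* The multiplier [t = a / n] becomes a summation variable; it lies in [I] because
   [t <= n * t = a <= B]. *)
transitivity (\sum_(a <- I) \sum_(b <- I) \sum_(t <- I)
                (t == a %/ n) * ((a == n * t) && (b == m * t)))%N.
  apply: eq_big_seq => a; rewrite mem_interval1 => /andP[a0 aB].
  apply: eq_big_seq => b; rewrite mem_interval1 => /andP[b0 bB].
  rewrite (sum_pred1_nat _ (a %/ n)%N (fun t => (a == n * t) && (b == m * t) : nat)%N)
     ?fset_uniq // mulnb; congr nat_of_bool.
  apply/eqP/and3P => [E|[_ /eqP ea /eqP eb]]; last first.
    by rewrite eb {2}ea -!mulnA; congr muln; rewrite mulnC.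
  have nda : (n %| a)%N by rewrite -(Gauss_dvdr _ co) -E dvdn_mull.
  have [t at_] := dvdnP nda; subst a.
  have bt : b = (m * t)%N.
    by apply/eqP; rewrite -(eqn_pmul2r n0) E mulnA.
  rewrite mulnK // mem_interval1 bt mulnC !eqxx; split=> //.
  move: a0; rewrite muln_gt0 n0 andbT => ->.
  by apply: (mul_le n) => //; rewrite mulnC.
(* Summing over [a] and [b] first leaves the [t] for which [n * t] and [m * t] are both at most
   [B]. *)
transitivity (\sum_(t <- I) (t <= B %/ maxn n m))%N.
  under eq_bigr => a _ do rewrite exchange_big /=.
  rewrite exchange_big /=; apply: eq_big_seq => t.
  rewrite mem_interval1 => /andP[t0 tB].
  transitivity (\sum_(a <- I) (a == n * t) * \sum_(b <- I) (b == m * t) * 1)%N.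
    apply: eq_bigr => a _; rewrite big_distrr /=; apply: eq_bigr => b _.
    rewrite muln1 -mulnb mulnA; congr muln.
    by case: (a =P _) => [->|]; rewrite ?mulKn ?eqxx ?muln0.
  rewrite (sum_pred1_nat _ (n * t)%N (fun=> _)) ?fset_uniq //.
  rewrite (sum_pred1_nat _ (m * t)%N (fun=> 1%N)) ?fset_uniq // muln1 mulnb.
  rewrite !mem_interval1 !muln_gt0 n0 m0 t0 /=; congr nat_of_bool.
  by rewrite leq_divRL ?leq_max ?n0 // maxnMr geq_max !(mulnC t).
have kB : (B %/ maxn n m <= B)%N by rewrite leq_div.
have -> : (\sum_(t <- I) (t <= B %/ maxn n m) =
           \sum_(t <- interval1 (B %/ maxn n m)%N) 1)%N.
  rewrite -big_mkcond /= -big_filter; apply: perm_big; apply: uniq_perm.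
  - by rewrite filter_uniq ?fset_uniq.
  - exact: fset_uniq.
  move=> t; rewrite mem_filter !mem_interval1.
  have [tk|tk] := leqP t (B %/ maxn n m)%N => /=.
    by rewrite (leq_trans tk kB).
  by rewrite andbF.
rewrite -card_fset_sum1 card_fseq undup_id ?iota_uniq // size_iota //.
Qed.

Lemma floor_divn (B k : nat) : (0 < k)%N ->
  Num.floor (B%:R / k%:R : rat) = (B %/ k)%N%:Z.
Proof.
move=> k0; apply: floor_def.
rewrite ler_pdivlMr ?ltr_pdivrMr ?ltr0n // -[_ + 1]/((B %/ k + 1)%N%:Z).
by rewrite -!pmulrn -!natrM ler_nat ltr_nat leq_trunc_div addn1 ltn_ceil.
Qed.

(** * Upper bound *)

Lemma leq_sum_fsubset (A C : {fset nat}) (f : nat -> nat) :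
  {subset A <= C} -> (\sum_(i <- A) f i <= \sum_(i <- C) f i)%N.
Proof.
move=> AC; rewrite (big_fsetID _ (mem A) C) /=.
have -> : [fset x in C | x \in A]%fset = A.
  by apply/fsetP => x; rewrite !inE /= andb_idl // => /AC.
exact: leq_addr.
Qed.

Lemma leq_ratio_count (A C : {fset nat}) (n m : nat) :
  {subset A <= C} -> positive_fset C -> (0 < n)%N ->
  (ratio_count A n m <= ratio_count C n m)%N.
Proof.
move=> AC Cpos n0; have Apos k : k \in A -> (0 < k)%N by move/AC/Cpos.
rewrite !ratio_countE //; apply: leq_trans (leq_sum_fsubset _ _ _ AC).
by apply: leq_sum => a _; apply: leq_sum_fsubset.
Qed.

Lemma leq_count_ltn (F : {fset nat}) (n : nat) :
  (\sum_(m <- F) (m < n) <= n)%N.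
Proof.
rewrite -big_mkcond /= sum1_count -size_filter -[leqRHS](size_iota 0).
apply: uniq_leq_size; first by rewrite filter_uniq ?fset_uniq.
by move=> m; rewrite mem_filter mem_iota => /andP[].
Qed.

(** At most [n] values of [m] lie below [n], each contributing [(B / n) ^ 2]; no positive [m] lies
    below [1]. *)
Lemma sum_ltn_inv_sqr (F : {fset nat}) (B n : nat) :
  positive_fset F -> (0 < n)%N ->
  \sum_(m <- F) (m < n)%N%:R * (B%:R / n%:R : rat) ^+ 2 <=
    if n != 1%N then B%:R ^+ 2 * (1 / n%:R) else 0.
Proof.
move=> Fpos n0; case: eqVneq => [->|n1] /=.
  rewrite big_seq big1 // => m /Fpos m0.
  by rewrite ltnS leqNgt m0 mul0r.
rewrite -big_distrl /= -natr_sum expr_div_n.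
have nn0 : n%:R != 0 :> rat by rewrite pnatr_eq0 -lt0n.
apply: (@le_trans _ _ (n%:R * (B%:R ^+ 2 / n%:R ^+ 2))).
  by rewrite ler_wpM2r ?divr_ge0 ?exprn_ge0 ?ler0n // ler_nat leq_count_ltn.
by rewrite mulrCA [n%:R ^+ 2]expr2 invfM mulVKf // mul1r.
Qed.

Lemma quad_count_upper (F : {fset nat}) (B : nat) :
  factor_closed F -> (forall k : nat, k \in F -> (1 <= k <= B)%N) ->
  ((quad_count (interval1 B) F)%:R : rat) <=
    2 * B%:R ^+ 2 * (\sum_(n <- F | n != 1%N) 1 / n%:R) + B%:R ^+ 2.
Proof.
move=> FC FB; have [_ Fpos _] := FC; have Ipos := @interval1_pos B.
have FI : {subset F <= interval1 B} by move=> k /FB; rewrite mem_interval1.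
rewrite quad_countE // natr_sum.
(* [T] majorizes each coprime term by splitting into [m < n], [n < m] and [n = m = 1]; being
   nonnegative, it also covers the non-coprime pairs. *)
pose T (n m : nat) : rat :=
  (m < n)%N%:R * (B%:R / n%:R) ^+ 2 + (n < m)%N%:R * (B%:R / m%:R) ^+ 2
  + ((n == 1%N) * ((m == 1%N) * 1))%N%:R * B%:R ^+ 2.
have T0 n m : 0 <= T n m.
  by rewrite !addr_ge0 // mulr_ge0 ?ler0n // exprn_ge0 ?divr_ge0 ?ler0n.
apply: (@le_trans _ _ (\sum_(n <- F) \sum_(m <- F) T n m)).
  rewrite big_seq [leRHS]big_seq; apply: ler_sum => n nF.
  rewrite natr_sum big_mkcond big_seq_cond [leRHS]big_seq_cond.
  apply: ler_sum => m /andP[mF _]; case: ifPn => // co.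
  have n0 := Fpos _ nF; have m0 := Fpos _ mF.
  have M0 : (0 < maxn n m)%N by rewrite leq_max n0.
  (* Both ratio counts are at most the count in [[1, B]], hence at most [B / max (n, m)]. *)
  apply: (@le_trans _ _ ((B%:R / (maxn n m)%:R) ^+ 2)).
    have le_div : (B %/ maxn n m)%N%:R <= B%:R / (maxn n m)%:R :> rat.
      by rewrite ler_pdivlMr ?ltr0n // -natrM ler_nat leq_trunc_div.
    have := leq_ratio_count F (interval1 B) n m FI Ipos n0.
    rewrite ratio_count_interval1 // natrM expr2 => le_R.
    by rewrite ler_pM ?ler0n // (le_trans _ le_div) // ler_nat.
  rewrite /T; case: (ltngtP m n) => [mn|nm|mn].
  - rewrite mul1r mul0r addr0 lerDl mulr_ge0 ?ler0n // exprn_ge0 //.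
  - by rewrite mul1r mul0r add0r lerDl mulr_ge0 ?ler0n // exprn_ge0.
  - move: co; rewrite mn /coprime gcdnn => /eqP->.
    by rewrite !mul0r !add0r eqxx mul1r divr1.
have sumT : \sum_(n <- F) \sum_(m <- F) (m < n)%N%:R * (B%:R / n%:R : rat) ^+ 2
    <= B%:R ^+ 2 * \sum_(n <- F | n != 1%N) 1 / n%:R.
  rewrite big_distrr /= [leRHS]big_mkcond /= big_seq [leRHS]big_seq.
  by apply: ler_sum => n nF; apply: sum_ltn_inv_sqr => //; apply: Fpos.
have sum1 : \sum_(n <- F) \sum_(m <- F)
    ((n == 1%N) * ((m == 1%N) * 1))%N%:R * (B%:R : rat) ^+ 2 <= B%:R ^+ 2.
  under eq_bigr => n _ do rewrite -big_distrl -natr_sum -big_distrr /=.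
  rewrite -big_distrl -natr_sum /= (sum_pred1_nat _ 1%N (fun=> _)) ?fset_uniq //.
  rewrite (sum_pred1_nat _ 1%N (fun=> 1%N)) ?fset_uniq // muln1 mulnb andbb.
  by case: (_ \in _); rewrite ?mul1r // mul0r exprn_ge0.
rewrite /T; under eq_bigr => n _ do rewrite !big_split /=.
(* Swapping [n] and [m] turns the part [n < m] into the part [m < n], whence the factor 2. *)
rewrite !big_split /= [X in _ + X + _]exchange_big /=.
by rewrite lerD // -mulrA mulr_natl mulr2n lerD.
Qed.

(** * Lower bound and the final statement *)

Lemma leq_sum_gcdn_quad_count (F : {fset nat}) (B : nat) :
  factor_closed F -> (forall k : nat, k \in F -> (1 <= k <= B)%N) ->
  (\sum_(mu <- F) \sum_(nu <- F) gcdn mu nu <= quad_count (interval1 B) F)%N.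
Proof.
move=> FC FB; have [_ Fpos _] := FC; have Ipos := @interval1_pos B.
rewrite quad_count_pairs // big_seq [leqRHS]big_seq.
apply: leq_sum => a aF; rewrite big_seq [leqRHS]big_seq.
apply: leq_sum => b bF; have a0 := Fpos _ aF; have b0 := Fpos _ bF.
have g0 : (0 < gcdn a b)%N by rewrite gcdn_gt0 a0.
have ag0 : (0 < a %/ gcdn a b)%N by rewrite divn_gt0 // dvdn_leq // dvdn_gcdl.
have bg0 : (0 < b %/ gcdn a b)%N by rewrite divn_gt0 // dvdn_leq // dvdn_gcdr.
(* The exact count in [[1, B]] is for coprime terms, so the ratio is reduced first. *)
rewrite -ratio_count_reduced // ratio_count_interval1 ?coprime_div_gcd //.
rewrite leq_divRL ?leq_max ?ag0 // maxnMr !(mulnC (gcdn a b)).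
rewrite !divnK ?dvdn_gcdl ?dvdn_gcdr // geq_max.
by have /andP[_ ->] := FB _ aF; have /andP[_ ->] := FB _ bF.
Qed.

Theorem proposition1p1 (F : {fset nat}) (B : nat)
  (hF : factor_closed F) (hB : (1 <= B)%N) :
  ((quad_count (interval1 B) F)%:Z =
     \sum_(n <- F) \sum_(m <- F | coprime n m)
       (ratio_count F n m)%:Z * Num.floor (B%:R / (maxn n m)%:R : rat))
  /\ ((forall k : nat, k \in F -> (1 <= k <= B)%N) ->
      [/\ ((quad_count (interval1 B) F)%:R : rat) <=
            2 * B%:R ^+ 2 * (\sum_(n <- F | n != 1%N) 1 / n%:R) + B%:R ^+ 2,
          (\sum_(mu <- F) \sum_(nu <- F) gcdn mu nu <=
            quad_count (interval1 B) F)%N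
        & quad_count F F =
            (\sum_(n <- F) \sum_(m <- F | coprime n m)
               ratio_count F n m ^ 2)%N ]).
Proof.
have [_ Fpos _] := hF; split=> [|FB].
  rewrite quad_countE //; last exact: interval1_pos.
  rewrite -natz natr_sum; apply: eq_big_seq => n nF.
  rewrite natr_sum big_seq_cond [RHS]big_seq_cond.
  apply: eq_bigr => m /andP[mF co]; have n0 := Fpos _ nF; have m0 := Fpos _ mF.
  by rewrite ratio_count_interval1 // floor_divn ?leq_max ?n0 // natrM !natz.
split; [exact: quad_count_upper | exact: leq_sum_gcdn_quad_count |].
by rewrite quad_countE //; apply: eq_bigr => n _; apply: eq_bigr => m _; rewrite -mulnn.
Qed.
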